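(* Let $T:C^1[0,1]\to C^1[0,1]$ be an isometric reflection of Form (III), i.e. there are $c\in\mathbb{C}$ with $|c|=1$, a continuous function $\beta:[0,1]\to\mathbb{C}$ with $|\beta(t)|=1$ for all $t$, and a homeomorphism $\phi:[0,1]\to[0,1]$ such that $$T(f)(t)=T(0)(t)+c f(0)+\int_0^t\beta(s)\overline{f'(\phi(s))}\,ds$$ for every $f\in C^1[0,1]$ and $t\in[0,1]$. Then $c=\pm1$, and $\beta(t)\overline{\beta(\phi(t))}=1$ and $\phi^2(t)=t$ for every $t\in[0,1]$.
   Context: $C^1[0,1]$ is the complex linear space of continuously differentiable complex-valued functions on $[0,1]$ with the norm $\|f\|_\sigma=|f(0)|+\|f'\|_\infty$. An isometry is a map $T$ (not assumed linear) with $\|Tf-Tg\|_\sigma=\|f-g\|_\sigma$ for all $f,g$; it is an isometric reflection if $T^2=T\circ T=I$, the identity map. $T(0)\in C^1[0,1]$ denotes the image of the zero function, and $\phi^2=\phi\circ\phi$. *)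

(* Defs.v *)
From Stdlib Require Import Reals Lra ProofIrrelevance FunctionalExtensionality.
From Coquelicot Require Import Coquelicot.
Open Scope R_scope.

Definition I01 : Type := {x : R | 0 <= x <= 1}.

Definition I01_val (t : I01) : R := proj1_sig t.
Coercion I01_val : I01 >-> R.

Lemma I01_eq (s t : I01) : (s : R) = t -> s = t.
Proof.
  destruct s as [s Hs], t as [t Ht]; unfold I01_val; simpl; intros ->.
  f_equal; apply proof_irrelevance.
Qed.

Lemma I01_0_proof : 0 <= 0 <= 1.
Proof. lra. Qed.

Definition I01_0 : I01 := exist _ 0 I01_0_proof.

Definition I01_ball (x : I01) (e : R) (y : I01) : Prop := ball (x : R) e (y : R).

Definition I01_UniformSpace_mixin : UniformSpace.mixin_of I01 :=
  UniformSpace.Mixin I01 I01_0 I01_ball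
    (fun x e => ball_center (x : R) e)
    (fun x y e => ball_sym (x : R) (y : R) e)
    (fun x y z e1 e2 => ball_triangle (x : R) (y : R) (z : R) e1 e2).

Canonical I01_UniformSpace : UniformSpace :=
  UniformSpace.Pack I01 I01_UniformSpace_mixin I01.

Lemma I01_clamp_proof (x : R) : 0 <= Rmax 0 (Rmin x 1) <= 1.
Proof.
  split; [apply Rmax_l|].
  apply Rmax_lub; [lra | apply Rmin_r].
Qed.

(* The nearest-point retraction of the line onto [0,1]: it turns a function on
   [0,1] into an integrand on R, and is the identity on the range of
   integration (I01_clamp_id). *)
Definition I01_clamp (x : R) : I01 :=
  exist _ (Rmax 0 (Rmin x 1)) (I01_clamp_proof x).

Lemma I01_clamp_id (t : I01) : I01_clamp t = t.
Proof.
  apply I01_eq; destruct t as [t Ht]; unfold I01_val; simpl.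
  rewrite Rmin_left by lra; apply Rmax_right; lra.
Qed.

(* Since s ranges over I01, this derivative is one-sided at 0 and at 1. *)
Definition is_derive_I01 (f : I01 -> C) (t : I01) (l : C) : Prop :=
  filterlim (fun s : I01 => ((f s - f t) / RtoC (s - t))%C) (locally' t) (locally l).

Global Instance I01_locally'_proper (t : I01) : ProperFilter' (locally' t).
Proof.
  constructor.
  - intros [e He].
    assert (H : exists u : I01, Rabs (u - t) < e /\ (u : R) <> t).
    { assert (Hpos := cond_pos e).
      destruct t as [t Ht].
      destruct (Rle_dec t (1/2)).
      - assert (Hd : 0 < Rmin (e/2) (1/2)) by (apply Rmin_glb_lt; lra).
        assert (H1 := Rmin_l (e/2) (1/2)); assert (H2 := Rmin_r (e/2) (1/2)).
        assert (Hu : 0 <= t + Rmin (e/2) (1/2) <= 1) by lra.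
        exists (exist (fun x : R => 0 <= x <= 1) _ Hu); unfold I01_val; simpl; split; [|lra].
        rewrite Rabs_pos_eq; lra.
      - assert (Hd : 0 < Rmin (e/2) (1/2)) by (apply Rmin_glb_lt; lra).
        assert (H1 := Rmin_l (e/2) (1/2)); assert (H2 := Rmin_r (e/2) (1/2)).
        assert (Hu : 0 <= t - Rmin (e/2) (1/2) <= 1) by lra.
        exists (exist (fun x : R => 0 <= x <= 1) _ Hu); unfold I01_val; simpl; split; [|lra].
        rewrite Rabs_left; lra. }
    destruct H as [u [Hu Hne]].
    apply (He u Hu).
    intros Heq; apply Hne; rewrite Heq; reflexivity.
  - apply within_filter, locally_filter.
Qed.

Lemma is_derive_I01_unique (f : I01 -> C) (t : I01) (l l' : C) :
  is_derive_I01 f t l -> is_derive_I01 f t l' -> l = l'.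
Proof.
  intros H H'.
  exact (@filterlim_locally_unique I01 C_AbsRing C_NormedModule (locally' t)
    (I01_locally'_proper t) _ l l' H H').
Qed.

(* The derivative is carried as data; it is determined by the function, and
   equality in C1I01 is equality of functions (C1I01_ext). *)
Record C1I01 : Type := mkC1I01 {
  C1I01_fun :> I01 -> C;
  C1I01_deriv : I01 -> C;
  C1I01_is_derive : forall t, is_derive_I01 C1I01_fun t (C1I01_deriv t);
  C1I01_deriv_continuous : forall t, continuous C1I01_deriv t
}.

Lemma C1I01_ext (f g : C1I01) : (forall t, f t = g t) -> f = g.
Proof.
  destruct f as [f f' Hf Cf], g as [g g' Hg Cg]; simpl; intros H.
  assert (f = g) by (apply functional_extensionality; exact H); subst g.
  assert (f' = g').
  { apply functional_extensionality; intros t.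
    exact (is_derive_I01_unique f t _ _ (Hf t) (Hg t)). }
  subst g'; f_equal; apply proof_irrelevance.
Qed.

Lemma C1I01_zero_is_derive (t : I01) : is_derive_I01 (fun _ => RtoC 0) t (RtoC 0).
Proof.
  apply filterlim_ext with (fun _ => RtoC 0).
  - intros s; unfold Cdiv; ring.
  - apply filterlim_const.
Qed.

Lemma C1I01_plus_is_derive (f g : C1I01) (t : I01) :
  is_derive_I01 (fun s => f s + g s)%C t (C1I01_deriv f t + C1I01_deriv g t)%C.
Proof.
  apply filterlim_ext with
    (fun s : I01 => plus ((f s - f t) / RtoC (s - t))%C ((g s - g t) / RtoC (s - t))%C).
  - intros s; unfold Cdiv; change plus with Cplus;
      match goal with |- ?a = ?b => change (@eq C a b) end; ring.
  - exact (filterlim_comp_2 _ _ _ (C1I01_is_derive f t) (C1I01_is_derive g t)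
      (@filterlim_plus C_AbsRing C_NormedModule _ _)).
Qed.

Lemma C1I01_scal_is_derive (a : C) (f : C1I01) (t : I01) :
  is_derive_I01 (fun s => a * f s)%C t (a * C1I01_deriv f t)%C.
Proof.
  apply filterlim_ext with (fun s : I01 => (a * ((f s - f t) / RtoC (s - t)))%C).
  - intros s; unfold Cdiv; ring.
  - exact (filterlim_comp _ _ _ _ _ _ _ _ (C1I01_is_derive f t)
      (@filterlim_scal_r C_AbsRing C_NormedModule a (C1I01_deriv f t))).
Qed.

Definition C1I01_zero : C1I01 :=
  mkC1I01 (fun _ => RtoC 0) (fun _ => RtoC 0) C1I01_zero_is_derive
    (fun t => continuous_const (RtoC 0) t).

Definition C1I01_plus (f g : C1I01) : C1I01 :=
  mkC1I01 (fun s => f s + g s)%C (fun s => C1I01_deriv f s + C1I01_deriv g s)%C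
    (C1I01_plus_is_derive f g)
    (fun t => @continuous_plus I01_UniformSpace C_AbsRing C_NormedModule _ _ t
       (C1I01_deriv_continuous f t) (C1I01_deriv_continuous g t)).

Definition C1I01_scal (a : C) (f : C1I01) : C1I01 :=
  mkC1I01 (fun s => a * f s)%C (fun s => a * C1I01_deriv f s)%C
    (C1I01_scal_is_derive a f)
    (fun t => @continuous_scal_r I01_UniformSpace C_AbsRing C_NormedModule a _ t
       (C1I01_deriv_continuous f t)).

Definition C1I01_opp (f : C1I01) : C1I01 := C1I01_scal (RtoC (-1)) f.

Lemma C1I01_plus_comm (f g : C1I01) : C1I01_plus f g = C1I01_plus g f.
Proof. apply C1I01_ext; intros t; simpl; ring. Qed.

Lemma C1I01_plus_assoc (f g h : C1I01) :
  C1I01_plus f (C1I01_plus g h) = C1I01_plus (C1I01_plus f g) h.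
Proof. apply C1I01_ext; intros t; simpl; ring. Qed.

Lemma C1I01_plus_zero_r (f : C1I01) : C1I01_plus f C1I01_zero = f.
Proof. apply C1I01_ext; intros t; simpl; ring. Qed.

Lemma C1I01_plus_opp_r (f : C1I01) : C1I01_plus f (C1I01_opp f) = C1I01_zero.
Proof. apply C1I01_ext; intros t; simpl; ring. Qed.

Definition C1I01_AbelianMonoid_mixin : AbelianMonoid.mixin_of C1I01 :=
  AbelianMonoid.Mixin C1I01 C1I01_plus C1I01_zero C1I01_plus_comm C1I01_plus_assoc C1I01_plus_zero_r.

Canonical C1I01_AbelianMonoid : AbelianMonoid :=
  AbelianMonoid.Pack C1I01 C1I01_AbelianMonoid_mixin C1I01.

Definition C1I01_AbelianGroup_mixin : AbelianGroup.mixin_of C1I01_AbelianMonoid :=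
  AbelianGroup.Mixin C1I01_AbelianMonoid C1I01_opp C1I01_plus_opp_r.

Canonical C1I01_AbelianGroup : AbelianGroup :=
  AbelianGroup.Pack C1I01
    (AbelianGroup.Class C1I01 C1I01_AbelianMonoid_mixin C1I01_AbelianGroup_mixin) C1I01.

Lemma C1I01_scal_assoc (a b : C) (f : C1I01) :
  C1I01_scal a (C1I01_scal b f) = C1I01_scal (a * b)%C f.
Proof. apply C1I01_ext; intros t; simpl; ring. Qed.

Lemma C1I01_scal_one (f : C1I01) : C1I01_scal (RtoC 1) f = f.
Proof. apply C1I01_ext; intros t; simpl; ring. Qed.

Lemma C1I01_scal_plus_l (a : C) (f g : C1I01) :
  C1I01_scal a (C1I01_plus f g) = C1I01_plus (C1I01_scal a f) (C1I01_scal a g).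
Proof. apply C1I01_ext; intros t; simpl; ring. Qed.

Lemma C1I01_scal_plus_r (a b : C) (f : C1I01) :
  C1I01_scal (a + b)%C f = C1I01_plus (C1I01_scal a f) (C1I01_scal b f).
Proof. apply C1I01_ext; intros t; simpl; ring. Qed.

Definition C1I01_ModuleSpace_mixin : ModuleSpace.mixin_of C_Ring C1I01_AbelianGroup :=
  ModuleSpace.Mixin C_Ring C1I01_AbelianGroup C1I01_scal
    C1I01_scal_assoc C1I01_scal_one C1I01_scal_plus_l C1I01_scal_plus_r.

Canonical C1I01_ModuleSpace : ModuleSpace C_Ring :=
  ModuleSpace.Pack C_Ring C1I01
    (ModuleSpace.Class C_Ring C1I01 (AbelianGroup.class C1I01_AbelianGroup)
       C1I01_ModuleSpace_mixin) C1I01.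

Definition sup_norm (g : I01 -> C) : R :=
  real (Lub_Rbar (fun y : R => exists t : I01, y = Cmod (g t))).

Lemma I01_clamp_continuous (x : R) : continuous I01_clamp x.
Proof.
  intros P [e He]; exists e; intros y Hy; apply He.
  assert (H : Rabs (y - x) < e) by exact Hy.
  change (Rabs (Rmax 0 (Rmin y 1) - Rmax 0 (Rmin x 1)) < e).
  revert H; unfold Rmax, Rmin.
  repeat destruct Rle_dec; unfold Rabs; repeat destruct Rcase_abs; lra.
Qed.

(* For continuous g the supremum is finite, so real is not applied to an
   infinite value. *)
Lemma sup_norm_is_lub (g : I01 -> C) : (forall t, continuous g t) ->
  is_lub (fun y : R => exists t : I01, y = Cmod (g t)) (sup_norm g).
Proof.
  intros Hg.
  destruct (continuity_ab_maj (fun x => Cmod (g (I01_clamp x))) 0 1) as [m [Hm Hm01]].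
  - lra.
  - intros x _; apply continuity_pt_filterlim.
    apply (continuous_comp (fun x => g (I01_clamp x)) Cmod).
    + apply continuous_comp; [apply I01_clamp_continuous | apply Hg].
    + exact (@filterlim_norm C_AbsRing C_NormedModule (g (I01_clamp x))).
  - assert (H := Lub_Rbar_correct (fun y : R => exists t : I01, y = Cmod (g t))).
    unfold sup_norm.
    assert (Hb : is_ub_Rbar (fun y : R => exists t : I01, y = Cmod (g t))
                   (Cmod (g (I01_clamp m)))).
    { intros y [t ->]; simpl; rewrite <- (I01_clamp_id t) at 1.
      apply Hm; exact (proj2_sig t). }
    assert (Hv := proj2 H _ Hb).
    assert (H0 := proj1 H _ (ex_intro _ I01_0 eq_refl)).
    destruct (Lub_Rbar (fun y : R => exists t : I01, y = Cmod (g t))) as [l| |];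
      simpl in Hv, H0; try contradiction.
    split.
    + intros y Hy; exact (proj1 H y Hy).
    + intros b Hbb; exact (proj2 H (Finite b) (fun y Hy => Hbb y Hy)).
Qed.

Definition norm_sigma (f : C1I01) : R := Cmod (f I01_0) + sup_norm (C1I01_deriv f).

Definition isometry (T : C1I01 -> C1I01) : Prop :=
  forall f g : C1I01, norm_sigma (minus (T f) (T g)) = norm_sigma (minus f g).

Definition isometric_reflection (T : C1I01 -> C1I01) : Prop :=
  isometry T /\ forall f : C1I01, T (T f) = f.

Definition homeomorphism_I01 (phi : I01 -> I01) : Prop :=
  (forall t, continuous phi t) /\
  exists psi : I01 -> I01,
    (forall t, continuous psi t) /\
    (forall t, psi (phi t) = t) /\ (forall t, phi (psi t) = t).

Definition integral_0 (g : I01 -> C) (t : I01) : C :=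
  RInt (V := C_R_CompleteNormedModule) (fun s : R => g (I01_clamp s)) 0 t.

Definition form_III (T : C1I01 -> C1I01) (c : C) (beta : I01 -> C) (phi : I01 -> I01) : Prop :=
  Cmod c = 1 /\
  (forall t, continuous beta t) /\ (forall t, Cmod (beta t) = 1) /\
  homeomorphism_I01 phi /\
  forall (f : C1I01) (t : I01),
    T f t = (T zero t + c * f I01_0
             + integral_0 (fun s => beta s * Cconj (C1I01_deriv f (phi s))) t)%C.

(* Main.v *)
Require Import Defs.
From Stdlib Require Import Reals Lra.
From Coquelicot Require Import Coquelicot.

(** A function of [C^1[0,1]] amounts to its value at [0] together with its
    derivative, an arbitrary continuous function: [C1_primitive] goes back from
    such a pair to the function.  In these coordinates the integral formula
    says that [T] sends [(f 0, f')] to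

      [(T(0)(0) + c f(0), T(0)' + beta . conj (f' o phi))],

    which is the content of [form_III_eq].  Applying it twice and comparing
    [T (T f) = f] with [T (T 0) = 0] cancels the contribution of [T 0]
    and leaves

      [c^2 f(0) = f(0)]  and
      [beta(t) conj(beta(phi(t))) f'(phi(phi(t))) = f'(t)].

    Now [f(0)] and [f'] can be chosen freely.  Taking [f(0) = 1] gives
    [c^2 = 1], taking [f' = 1] gives the identity for [beta], and with that
    identity [f'(t) = t] gives [phi(phi(t)) = t]. *)

(** * Continuity of complex-valued functions *)

Lemma continuous_Cmult {U : UniformSpace} (f g : U -> C) (x : U) :
  continuous f x -> continuous g x -> continuous (fun y => (f y * g y)%C) x.
Proof.
  intros Hf Hg.
  refine (filterlim_comp_2 _ _ _ _ Hg
            (@filterlim_scal C_AbsRing C_NormedModule (f x) (g x))).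
  (* Scalars carry the uniform structure of the modulus, and values the product
     one; the two have the same neighbourhoods. *)
  intros P HP; apply Hf, locally_C, HP.
Qed.

Lemma continuous_Cconj (z : C) : continuous Cconj z.
Proof.
  intros P [e He]; exists e; intros y [H1 H2]; apply He; split; [exact H1|].
  change (Rabs (snd y - snd z) < e) in H2.
  change (Rabs (- snd y - - snd z) < e).
  now replace (- snd y - - snd z) with (- (snd y - snd z)) by ring;
    rewrite Rabs_Ropp.
Qed.

(** * Primitives on the unit interval *)

Lemma norm_C_R (z : C) : @norm R_AbsRing C_R_NormedModule z = Cmod z.
Proof.
  unfold Cmod; change (sqrt (Rabs (fst z) ^ 2 + Rabs (snd z) ^ 2)
                       = sqrt (fst z ^ 2 + snd z ^ 2)).
  now rewrite !pow2_abs.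
Qed.

(** Differentiability on the line bounds the remainder
    [F y - F x - (y - x) l] by [eps |y - x|]; dividing by [y - x] and keeping
    only the points [y] of the interval gives the difference quotients. *)
Lemma is_derive_I01_restrict (F : R -> C) (t : I01) (l : C) :
  is_derive (V := C_R_NormedModule) F t l ->
  is_derive_I01 (fun s : I01 => F s) t l.
Proof.
  intros [_ HF].
  specialize (HF (t : R) (fun P H => H)).
  refine (proj2 (filterlim_locally (U := C_UniformSpace) _ _) _).
  intros eps.
  destruct (HF (pos_div_2 eps)) as [d Hd].
  refine (ex_intro _ d (fun (s : I01) Hs Hne => _)).
  assert (Hst : (s - t)%R <> 0).
  { intros H; apply Hne, I01_eq; lra. }
  apply (@norm_compat1 C_AbsRing C_NormedModule).
  specialize (Hd s Hs); rewrite norm_C_R in Hd.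
  change (norm (minus (s : R) t)) with (Rabs (s - t)) in Hd.
  change (Cmod ((F s - F t) / RtoC (s - t) - l)%C < eps).
  assert (Hst' : RtoC (s - t) <> 0%C).
  { intros H; apply Hst, RtoC_inj, H. }
  replace ((F s - F t) / RtoC (s - t) - l)%C
    with ((F s - F t - RtoC (s - t) * l) / RtoC (s - t))%C
    by (field; exact Hst').
  rewrite Cmod_div, Cmod_R by exact Hst'.
  assert (Hpos : 0 < Rabs (s - t)) by now apply Rabs_pos_lt.
  apply Rle_lt_trans with (eps / 2); [| destruct eps; simpl; lra].
  apply Rle_div_l; [exact Hpos|].
  replace (F s - F t - RtoC (s - t) * l)%C
    with (minus (minus (F s) (F t)) (scal (minus (s : R) t) l)
            : C_R_NormedModule); [exact Hd|].
  rewrite <- scal_R_Cmult; reflexivity.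
Qed.

Lemma clamp_integrand_continuous (g : I01 -> C) (x : R) :
  (forall t, continuous g t) ->
  continuous (U := C_R_NormedModule) (fun s : R => g (I01_clamp s)) x.
Proof.
  intros Hg.
  exact (continuous_comp I01_clamp g x (I01_clamp_continuous x) (Hg _)).
Qed.

Lemma is_derive_I01_primitive (a : C) (g : I01 -> C)
  (Hg : forall t, continuous g t) (t : I01) :
  is_derive_I01 (fun s => a + integral_0 g s)%C t (g t).
Proof.
  apply (is_derive_I01_restrict
           (fun x => a + RInt (V := C_R_CompleteNormedModule)
                           (fun s : R => g (I01_clamp s)) 0 x)%C).
  rewrite <- (I01_clamp_id t) at 2.
  rewrite <- (plus_zero_l (g (I01_clamp t) : C_R_NormedModule)).
  apply (is_derive_plus (V := C_R_NormedModule) (fun _ => a)).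
  - apply is_derive_const.
  - apply (is_derive_RInt (V := C_R_NormedModule)
             (fun s : R => g (I01_clamp s)) _ 0).
    + apply filter_forall; intros x.
      apply (RInt_correct (V := C_R_CompleteNormedModule)).
      apply (ex_RInt_continuous (V := C_R_CompleteNormedModule)).
      intros z _; now apply clamp_integrand_continuous.
    + now apply clamp_integrand_continuous.
Qed.

Definition C1_primitive (a : C) (g : I01 -> C)
  (Hg : forall t, continuous g t) : C1I01 :=
  mkC1I01 (fun t => a + integral_0 g t)%C g (is_derive_I01_primitive a g Hg) Hg.

Lemma C1_primitive_0 (a : C) (g : I01 -> C) (Hg : forall t, continuous g t) :
  C1_primitive a g Hg I01_0 = a.
Proof.
  change (plus (a : C_R_CompleteNormedModule)
            (RInt (V := C_R_CompleteNormedModule)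
               (fun s : R => g (I01_clamp s)) 0 0) = a).
  now rewrite RInt_point, plus_zero_r.
Qed.

(** * Maps of Form (III) *)

(** The integral formula as an identity in [C^1[0,1]]: it can then be read
    both at the point [0] and after differentiation. *)
Lemma form_III_eq (T : C1I01 -> C1I01) (c : C) (beta : I01 -> C)
  (phi : I01 -> I01) (f : C1I01) :
  form_III T c beta phi ->
  exists H : forall t,
      continuous (fun s => beta s * Cconj (C1I01_deriv f (phi s)))%C t,
    T f = plus (T zero) (C1_primitive (c * f I01_0)%C _ H).
Proof.
  intros (_ & Hb & _ & [Hphi _] & HT).
  assert (H : forall t,
      continuous (fun s => beta s * Cconj (C1I01_deriv f (phi s)))%C t).
  { intros t; apply continuous_Cmult; [apply Hb|].
    apply (continuous_comp (fun s => C1I01_deriv f (phi s)) Cconj);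
      [| apply continuous_Cconj].
    apply continuous_comp; [apply Hphi | apply C1I01_deriv_continuous]. }
  exists H; apply C1I01_ext; intros t.
  rewrite HT.
  change (T zero t + c * f I01_0
            + integral_0 (fun s => beta s * Cconj (C1I01_deriv f (phi s))) t
          = T zero t + (c * f I01_0
            + integral_0 (fun s => beta s * Cconj (C1I01_deriv f (phi s))) t))%C.
  ring.
Qed.

Lemma form_III_at_0 (T : C1I01 -> C1I01) (c : C) (beta : I01 -> C)
  (phi : I01 -> I01) (f : C1I01) :
  form_III T c beta phi -> T f I01_0 = (T zero I01_0 + c * f I01_0)%C.
Proof.
  intros HT; destruct (form_III_eq T c beta phi f HT) as [H Hf].
  rewrite Hf at 1.
  change (plus (T zero) (C1_primitive (c * f I01_0) _ H) I01_0)%C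
    with (T zero I01_0 + C1_primitive (c * f I01_0) _ H I01_0)%C.
  now rewrite C1_primitive_0.
Qed.

Lemma form_III_deriv (T : C1I01 -> C1I01) (c : C) (beta : I01 -> C)
  (phi : I01 -> I01) (f : C1I01) (t : I01) :
  form_III T c beta phi ->
  C1I01_deriv (T f) t
  = (C1I01_deriv (T zero) t + beta t * Cconj (C1I01_deriv f (phi t)))%C.
Proof.
  intros HT; destruct (form_III_eq T c beta phi f HT) as [H Hf].
  now rewrite Hf at 1.
Qed.

Lemma form_III_involutive_at_0 (T : C1I01 -> C1I01) (c : C)
  (beta : I01 -> C) (phi : I01 -> I01) (f : C1I01) :
  form_III T c beta phi -> (forall g, T (T g) = g) ->
  (c * c * f I01_0)%C = f I01_0.
Proof.
  intros HT Hinv.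
  assert (Hf := form_III_at_0 T c beta phi (T f) HT).
  assert (H0 := form_III_at_0 T c beta phi (T zero) HT).
  rewrite Hinv in Hf, H0; rewrite (form_III_at_0 T c beta phi f HT) in Hf.
  change ((zero : C1I01) I01_0) with (RtoC 0) in H0.
  rewrite Hf at 2.
  replace (T zero I01_0 + c * (T zero I01_0 + c * f I01_0))%C
    with (T zero I01_0 + c * T zero I01_0 + c * c * f I01_0)%C by ring.
  rewrite <- H0; ring.
Qed.

Lemma form_III_involutive_deriv (T : C1I01 -> C1I01) (c : C)
  (beta : I01 -> C) (phi : I01 -> I01) (f : C1I01) (t : I01) :
  form_III T c beta phi -> (forall g, T (T g) = g) ->
  (beta t * Cconj (beta (phi t)) * C1I01_deriv f (phi (phi t)))%C
  = C1I01_deriv f t.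
Proof.
  intros HT Hinv.
  assert (Hf := form_III_deriv T c beta phi (T f) t HT).
  assert (H0 := form_III_deriv T c beta phi (T zero) t HT).
  rewrite Hinv in Hf, H0.
  rewrite (form_III_deriv T c beta phi f (phi t) HT) in Hf.
  rewrite Cplus_conj, Cmult_conj, Cconj_conj in Hf.
  change (C1I01_deriv (zero : C1I01) t) with (RtoC 0) in H0.
  rewrite Hf.
  set (u := C1I01_deriv (T zero) t) in *.
  set (v := Cconj (C1I01_deriv (T zero) (phi t))) in *.
  set (w := C1I01_deriv f (phi (phi t))).
  replace (u + beta t * (v + Cconj (beta (phi t)) * w))%C
    with (u + beta t * v + beta t * Cconj (beta (phi t)) * w)%C by ring.
  rewrite <- H0; ring.
Qed.

(** * Isometric reflections of Form (III) *)

Lemma Csqr_eq_1 (c : C) : (c * c)%C = RtoC 1 -> c = RtoC 1 \/ c = RtoC (-1).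
Proof.
  intros H.
  destruct (Ceq_dec c 1) as [H1 | H1]; [now left | right].
  assert (Hn : (c - 1)%C <> 0%C).
  { intros Hc; apply H1; replace c with (c - 1 + 1)%C by ring.
    rewrite Hc; ring. }
  replace c with ((c * c - 1) / (c - 1) - 1)%C by (field; exact Hn).
  rewrite H; replace (1 - 1)%C with (RtoC 0) by ring.
  change (RtoC (-1)) with (RtoC (- (1))); rewrite RtoC_opp; field; exact Hn.
Qed.

Lemma continuous_I01_val (t : I01) : continuous (fun s : I01 => RtoC s) t.
Proof.
  intros P [e He]; exists e; intros y Hy; apply He.
  split; [exact Hy | apply ball_center].
Qed.

Theorem theorem2p3 (T : C1I01 -> C1I01) (c : C) (beta : I01 -> C) (phi : I01 -> I01)
  (HT : isometric_reflection T)
  (HIII : form_III T c beta phi) :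
  (c = RtoC 1 \/ c = RtoC (-1)) /\
  (forall t : I01, (beta t * Cconj (beta (phi t)))%C = RtoC 1) /\
  (forall t : I01, phi (phi t) = t).
Proof.
  destruct HT as [_ Hinv].
  pose (p := C1_primitive (RtoC 1) (fun _ => RtoC 1)
               (fun t => continuous_const (RtoC 1) t)).
  pose (q := C1_primitive (RtoC 0) (fun s => RtoC s) continuous_I01_val).
  assert (Hbeta : forall t, (beta t * Cconj (beta (phi t)))%C = RtoC 1).
  { intros t.
    assert (H := form_III_involutive_deriv T c beta phi p t HIII Hinv).
    simpl in H; now rewrite Cmult_1_r in H. }
  repeat split.
  - apply Csqr_eq_1.
    assert (H := form_III_involutive_at_0 T c beta phi p HIII Hinv).
    unfold p in H; rewrite C1_primitive_0 in H.
    now rewrite Cmult_1_r in H.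
  - exact Hbeta.
  - intros t; apply I01_eq, RtoC_inj.
    assert (H := form_III_involutive_deriv T c beta phi q t HIII Hinv).
    simpl in H; now rewrite Hbeta, Cmult_1_l in H.
Qed.
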